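(* Let $d,n,m\geq1$ be positive integers and let $P(z)=\prod_{i=1}^d(z-a_i)$ and $Q(z)=\prod_{i=1}^d(z-b_i)$ be polynomials in $\mathbb{C}[z]$ with simple roots. Let $W_{n,P}$ and $W_{m,Q}$ denote the hypersurfaces in $\mathbb{A}^3=\mathrm{Spec}(\mathbb{C}[x,y,z])$ defined respectively by the equations $$W_{n,P}\colon x^ny=P(z)\qquad\text{and}\qquad W_{m,Q}\colon x^my=Q(z).$$ Let $f,g\in\mathbb{C}[z]$ be two polynomials such that $$f(b_i)=a_i\quad\text{and}\quad f^{(k)}(b_i)=0\quad\text{for all }1\leq i\leq d,\ 1\leq k\leq n-1,$$ and $$g(a_i)=b_i\quad\text{and}\quad g^{(k)}(a_i)=0\quad\text{for all }1\leq i\leq d,\ 1\leq k\leq m-1.$$ Then the maps $$\varphi\colon W_{n,P}\times\mathbb{A}^1\to W_{m,Q}\times\mathbb{A}^1,\quad (x,y,z,w)\mapsto\Big(x,\ \frac{Q(g(z)+x^mw)}{x^m},\ g(z)+x^mw,\ \frac{z-f(g(z)+x^mw)}{x^n}\Big)$$ and $$\psi\colon W_{m,Q}\times\mathbb{A}^1\to W_{n,P}\times\mathbb{A}^1,\quad (x,y,z,w)\mapsto\Big(x,\ \frac{P(f(z)+x^nw)}{x^n},\ f(z)+x^nw,\ \frac{z-g(f(z)+x^nw)}{x^m}\Big)$$ are regular and define inverse isomorphisms between the cylinders $W_{n,P}\times\mathbb{A}^1$ and $W_{m,Q}\times\mathbb{A}^1$.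
   Context: All varieties are over $\mathbb{C}$. The coordinate $w$ is the coordinate on the factor $\mathbb{A}^1$, and $f^{(k)}$ denotes the $k$-th derivative of $f$. Regularity of the maps means that the rational expressions displayed (with powers of $x$ in the denominator) are elements of the coordinate rings $\mathbb{C}[x,y,z,w]/(x^ny-P(z))$ of $W_{n,P}\times\mathbb{A}^1$ and $\mathbb{C}[x,y,z,w]/(x^my-Q(z))$ of $W_{m,Q}\times\mathbb{A}^1$, respectively. *)

(* Defs.v *)
From HB Require Import structures.
From mathcomp Require Import all_boot all_order all_algebra.
From mathcomp Require Import generic_quotient ring_quotient fraction.
From mathcomp Require Import mpoly complex ring.
From mathcomp Require Import boolp reals.

Set Implicit Arguments.
Unset Strict Implicit.
Unset Printing Implicit Defensive.

Import GRing.Theory.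
Local Open Scope ring_scope.
Local Notation "x %:F" := (@tofrac _ x).

Definition ix : 'I_4 := @Ordinal 4 0 isT.
Definition iy : 'I_4 := @Ordinal 4 1 isT.
Definition iz : 'I_4 := @Ordinal 4 2 isT.
Definition iw : 'I_4 := @Ordinal 4 3 isT.

Section Cylinder.
Variable K : fieldType.

Definition rootpoly d (a : 'I_d -> K) : {poly K} :=
  \prod_(i < d) ('X - (a i)%:P).

Lemma mpoly_ring_ind k (S : {mpoly K[k]} -> Prop) :
    (forall c, S c%:MP) -> (forall i, S 'X_i) ->
    (forall p q, S p -> S q -> S (p + q)) ->
    (forall p q, S p -> S q -> S (p * q)) ->
  forall p, S p.
Proof.
move=> SC SX SD SM; elim/mpolyind => [|c m p _ _ Sp].
  by rewrite -mpolyC0.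
apply: SD => //; rewrite -mul_mpolyC; apply: (SM) => //.
rewrite mpolyXE_id; apply: (big_ind S); [by rewrite -mpolyC1 | exact: (SM) | move=> i _].
by elim: (m i) => [|j IHj]; [rewrite expr0 -mpolyC1 | rewrite exprS; apply: SM].
Qed.

Section Ring.
Variables (n d : nat) (a : 'I_d -> K).

(* The cylinder W_{n,P} x A^1 in A^4, with P = rootpoly a; the fourth
   coordinate w is free. *)
Definition cyl_eqn : {mpoly K[4]} :=
  'X_ix ^+ n * 'X_iy - horner_alg 'X_iz (rootpoly a).

Definition cyl_ideal : {pred {mpoly K[4]}} :=
  fun p => `[< exists q, p = q * cyl_eqn >].

Lemma cyl_idealP p : reflect (exists q, p = q * cyl_eqn) (p \in cyl_ideal).
Proof. exact: asboolP. Qed.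

(* Primality of the ideal: its elements are exactly the polynomials killed by
   y |-> P(z)/x^n, with values in the field K(x, y, z, w). *)
Let xF : {fraction {mpoly K[4]}} := ('X_ix)%:F.

Let yval : {fraction {mpoly K[4]}} :=
  (horner_alg 'X_iz (rootpoly a) : {mpoly K[4]})%:F / xF ^+ n.

Let theta : {rmorphism {mpoly K[4]} -> {fraction {mpoly K[4]}}} :=
  mmap ((@tofrac _) \o @mpolyC 4 K)
       (fun i => if i == iy then yval else ('X_i)%:F).

Let mpolyX_neq0 : 'X_ix != 0 :> {mpoly K[4]}.
Proof. by rewrite -msupp_eq0 msuppX. Qed.

Let xF0 k : xF ^+ k != 0.
Proof. by rewrite expf_neq0 // tofrac_eq0. Qed.

Let theta_C c : theta c%:MP = (c%:MP)%:F.
Proof. by rewrite /theta /= mmapC. Qed.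

Let theta_X i : theta 'X_i = if i == iy then yval else ('X_i)%:F.
Proof. by rewrite /theta /= mmapX mmap1U. Qed.

Let theta_horner (p : {poly K}) :
  theta (horner_alg 'X_iz p) = (horner_alg 'X_iz p : {mpoly K[4]})%:F.
Proof.
elim/poly_ind: p => [|p c IHp]; first by rewrite !rmorph0.
rewrite !rmorphD !rmorphM /= !horner_algX !horner_algC !alg_mpolyC.
by rewrite theta_C -IHp; congr (_ * _ + _); rewrite theta_X.
Qed.

Let theta_eqn : theta cyl_eqn = 0.
Proof.
rewrite /cyl_eqn rmorphB rmorphM rmorphXn /= !theta_X theta_horner /=.
by rewrite /yval mulrCA divff ?mulr1 ?subrr // (xF0 n).
Qed.

Let clear_y p : exists N q h,
  'X_ix ^+ N * p = q + h * cyl_eqn /\ theta q = q%:F.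
Proof.
have addP p1 p2 :
    (exists N q h, 'X_ix ^+ N * p1 = q + h * cyl_eqn /\ theta q = q%:F) ->
    (exists N q h, 'X_ix ^+ N * p2 = q + h * cyl_eqn /\ theta q = q%:F) ->
    exists N q h,
      'X_ix ^+ N * (p1 + p2) = q + h * cyl_eqn /\ theta q = q%:F.
  move=> [N1 [q1 [h1 [E1 T1]]]] [N2 [q2 [h2 [E2 T2]]]].
  exists (N1 + N2)%N, ('X_ix ^+ N2 * q1 + 'X_ix ^+ N1 * q2),
    ('X_ix ^+ N2 * h1 + 'X_ix ^+ N1 * h2); split.
    transitivity ('X_ix ^+ N2 * ('X_ix ^+ N1 * p1)
      + 'X_ix ^+ N1 * ('X_ix ^+ N2 * p2)); first by rewrite exprD; ring.
    by rewrite E1 E2; ring.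
  by rewrite !rmorphD !rmorphM !rmorphXn /= theta_X /= T1 T2.
have mulP p1 p2 :
    (exists N q h, 'X_ix ^+ N * p1 = q + h * cyl_eqn /\ theta q = q%:F) ->
    (exists N q h, 'X_ix ^+ N * p2 = q + h * cyl_eqn /\ theta q = q%:F) ->
    exists N q h,
      'X_ix ^+ N * (p1 * p2) = q + h * cyl_eqn /\ theta q = q%:F.
  move=> [N1 [q1 [h1 [E1 T1]]]] [N2 [q2 [h2 [E2 T2]]]].
  exists (N1 + N2)%N, (q1 * q2),
    (q1 * h2 + h1 * q2 + h1 * cyl_eqn * h2); split.
    by rewrite exprD mulrACA E1 E2; ring.
  by rewrite !rmorphM /= T1 T2.
have constP c :
    exists N q h, 'X_ix ^+ N * c%:MP = q + h * cyl_eqn /\ theta q = q%:F.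
  by exists 0%N, c%:MP, 0; rewrite expr0 mul1r mul0r addr0.
have varP i :
    exists N q h, 'X_ix ^+ N * 'X_i = q + h * cyl_eqn /\ theta q = q%:F.
  have [->|ni] := eqVneq i iy; last first.
    by exists 0%N, 'X_i, 0;
       rewrite expr0 mul1r mul0r addr0 theta_X (negPf ni).
  exists n, (horner_alg 'X_iz (rootpoly a)), 1.
  by rewrite mul1r addrC subrK theta_horner.
exact: (mpoly_ring_ind constP varP addP mulP).
Qed.

Let at_x0 : {rmorphism {mpoly K[4]} -> {mpoly K[4]}} :=
  mmap (@mpolyC 4 K) (fun i => if i == ix then 0 else 'X_i).

Let at_x0X i : at_x0 'X_i = if i == ix then 0 else 'X_i.
Proof. by rewrite /at_x0 /= mmapX mmap1U. Qed.

Let at_x0C c : at_x0 c%:MP = c%:MP.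
Proof. by rewrite /at_x0 /= mmapC. Qed.

Let at_x0P p : exists q, p = 'X_ix * q + at_x0 p.
Proof.
have addP p1 p2 : (exists q, p1 = 'X_ix * q + at_x0 p1) ->
    (exists q, p2 = 'X_ix * q + at_x0 p2) ->
    exists q, p1 + p2 = 'X_ix * q + at_x0 (p1 + p2).
  move=> [q1 E1] [q2 E2]; exists (q1 + q2).
  by rewrite {1}E1 {1}E2 mulrDr rmorphD addrACA.
have mulP p1 p2 : (exists q, p1 = 'X_ix * q + at_x0 p1) ->
    (exists q, p2 = 'X_ix * q + at_x0 p2) ->
    exists q, p1 * p2 = 'X_ix * q + at_x0 (p1 * p2).
  move=> [q1 E1] [q2 E2]; exists (q1 * p2 + at_x0 p1 * q2).
  rewrite rmorphM /= [in LHS]E1 mulrDl {2}E2.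
  by ring.
have constP c : exists q, c%:MP = 'X_ix * q + at_x0 c%:MP.
  by exists 0; rewrite mulr0 add0r at_x0C.
have varP i : exists q, 'X_i = 'X_ix * q + at_x0 'X_i.
  rewrite at_x0X; have [->|_] := eqVneq i ix; [exists 1 | exists 0].
    by rewrite mulr1 addr0.
  by rewrite mulr0 add0r.
exact: (mpoly_ring_ind constP varP addP mulP).
Qed.

Let at_x0_eqn : at_x0 cyl_eqn != 0.
Proof.
pose s : {mpoly K[4]} -> {poly K} :=
  mmap polyC (fun i => if i == iz then 'X else 0).
pose sM : {rmorphism {mpoly K[4]} -> {poly K}} := s.
have sX i : sM 'X_i = if i == iz then 'X else 0.
  by rewrite /sM /= /s mmapX mmap1U.
have sC c : sM c%:MP = c%:P by rewrite /sM /= /s mmapC.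
have sat_horner p : sM (at_x0 (horner_alg 'X_iz p)) = p.
  elim/poly_ind: p => [|p c IHp]; first by rewrite !rmorph0.
  rewrite !rmorphD !rmorphM /= !horner_algX !horner_algC !alg_mpolyC.
  by rewrite at_x0C sC IHp at_x0X sX.
apply/eqP => /(congr1 sM); rewrite rmorph0 /cyl_eqn 2!rmorphB 2!rmorphM.
rewrite sat_horner /= (at_x0X iy) sX mulr0 sub0r => /eqP.
by rewrite oppr_eq0 (negPf (monic_neq0 (monic_prod_XsubC _ _ _))).
Qed.

Let xreg N p : 'X_ix ^+ N * p \in cyl_ideal -> p \in cyl_ideal.
Proof.
elim: N p => [|N IHN] p; first by rewrite expr0 mul1r.
rewrite exprSr -mulrA => /IHN/cyl_idealP[h E]; apply/cyl_idealP.
have /eqP : at_x0 ('X_ix * p) = 0 by rewrite rmorphM /= at_x0X mul0r.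
rewrite E rmorphM /= mulf_eq0 (negPf at_x0_eqn) orbF => /eqP h0.
have [q] := at_x0P h; rewrite [at_x0 h]h0 addr0 => hE; exists q.
apply: (@mulfI _ 'X_ix); first exact: mpolyX_neq0.
by rewrite E hE mulrA.
Qed.

Let in_idealE p : (p \in cyl_ideal) = (theta p == 0).
Proof.
apply/idP/eqP => [/cyl_idealP[q ->]|p0].
  by rewrite rmorphM /= theta_eqn mulr0.
have [N [q [h [E T]]]] := clear_y p.
apply: (@xreg N); apply/cyl_idealP; exists h; rewrite E.
move/(congr1 theta): E.
rewrite rmorphM /= p0 mulr0 rmorphD rmorphM /= theta_eqn mulr0 addr0 T.
by move/esym/eqP; rewrite tofrac_eq0 => /eqP ->; rewrite add0r.
Qed.

Lemma cyl_ideal_closed : idealr_closed cyl_ideal.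
Proof.
split; rewrite ?in_idealE ?rmorph0 ?rmorph1 ?oner_eq0 //.
move=> q u v; rewrite !in_idealE rmorphD rmorphM /= => /eqP-> /eqP->.
by rewrite mulr0 addr0.
Qed.

Lemma cyl_ideal_prime : prime_idealr_closed cyl_ideal.
Proof. by move=> u v; rewrite !in_idealE rmorphM mulf_eq0. Qed.

HB.instance Definition _ := isIdealr.Build _ cyl_ideal cyl_ideal_closed.
HB.instance Definition _ :=
  isPrimeIdealrClosed.Build _ cyl_ideal cyl_ideal_prime.

(* The coordinate ring K[x,y,z,w]/(x^n y - P(z)). *)
Definition cylring := {ideal_quot cyl_ideal}.

HB.instance Definition _ := GRing.ComNzRing.on cylring.

Definition cyl_pi : {mpoly K[4]} -> cylring := \pi_cylring%qT.

Lemma cyl_pi_zmod_morphism : zmod_morphism cyl_pi.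
Proof. exact: (rmorphB (\pi_cylring)%qT). Qed.

Lemma cyl_pi_monoid_morphism : monoid_morphism cyl_pi.
Proof.
split; first exact: (rmorph1 (\pi_cylring)%qT).
exact: (rmorphM (\pi_cylring)%qT).
Qed.

HB.instance Definition _ :=
  GRing.isZmodMorphism.Build _ _ cyl_pi cyl_pi_zmod_morphism.
HB.instance Definition _ :=
  GRing.isMonoidMorphism.Build _ _ cyl_pi cyl_pi_monoid_morphism.

Definition cyl_scale (c : K) (u : cylring) : cylring := cyl_pi c%:MP * u.

Lemma cyl_scaleA c1 c2 u :
  cyl_scale c1 (cyl_scale c2 u) = cyl_scale (c1 * c2) u.
Proof. by rewrite /cyl_scale mulrA mpolyCM rmorphM. Qed.

Lemma cyl_scale1 : left_id 1 cyl_scale.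
Proof. by move=> u; rewrite /cyl_scale mpolyC1 rmorph1 mul1r. Qed.

Lemma cyl_scaleDr : right_distributive cyl_scale +%R.
Proof. by move=> c u v; rewrite /cyl_scale mulrDr. Qed.

Lemma cyl_scaleDl u : {morph cyl_scale^~ u : c1 c2 / c1 + c2}.
Proof. by move=> c1 c2; rewrite /cyl_scale mpolyCD rmorphD mulrDl. Qed.

HB.instance Definition _ := GRing.Zmodule_isLmodule.Build K cylring
  cyl_scaleA cyl_scale1 cyl_scaleDr cyl_scaleDl.

Lemma cyl_scaleAl c (u v : cylring) : c *: (u * v) = c *: u * v.
Proof. exact: mulrA. Qed.

HB.instance Definition _ := GRing.Lmodule_isLalgebra.Build K cylring
  cyl_scaleAl.

Lemma cyl_scaleAr c (u v : cylring) : c *: (u * v) = u * (c *: v).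
Proof. exact: mulrCA. Qed.

HB.instance Definition _ := GRing.Lalgebra_isAlgebra.Build K cylring
  cyl_scaleAr.

Definition cyl_unit : pred cylring := fun u => `[< exists v, v * u = 1 >].

Definition cyl_inv (u : cylring) : cylring :=
  if pselect (exists v, v * u = 1) is left ex then projT1 (cid ex) else u.

Lemma cyl_mulVr : {in cyl_unit, left_inverse 1 cyl_inv *%R}.
Proof.
move=> u /asboolP ex; rewrite /cyl_inv; case: pselect => // ex'.
by case: (cid ex').
Qed.

Lemma cyl_unitP (u v : cylring) : v * u = 1 -> u \in cyl_unit.
Proof. by move=> vu; apply/asboolP; exists v. Qed.

Lemma cyl_inv_out : {in [predC cyl_unit], cyl_inv =1 id}.
Proof.
move=> u nu; rewrite /cyl_inv; case: pselect => // ex.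
by case/negP: nu; apply/asboolP.
Qed.

HB.instance Definition _ := GRing.ComNzRing_hasMulInverse.Build cylring
  cyl_mulVr cyl_unitP cyl_inv_out.

HB.instance Definition _ := GRing.ComUnitRing_isIntegral.Build cylring
  (@Quotient.rquot_IdomainAxiom _ cyl_ideal).

Definition cyl_coord (i : 'I_4) : cylring := cyl_pi 'X_i.

(* K-rational points; these are all the closed points when K is algebraically
   closed. *)
Definition cyl_pt := {v : {ffun 'I_4 -> K} | cyl_eqn.@[v] == 0}.

(* Independent of the representative, see cyl_evalE. *)
Definition cyl_eval (u : cylring) (v : cyl_pt) : K := (repr u).@[val v].

Lemma cyl_evalE p v : cyl_eval (cyl_pi p) v = p.@[val v].
Proof.
have: cyl_pi p = cyl_pi (repr (cyl_pi p)) by rewrite /cyl_pi reprK.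
rewrite /cyl_eval; move: (repr _) => q /eqP.
rewrite -subr_eq0 -rmorphB -(rmorph0 cyl_pi) => /eqP.
move/eqP; rewrite /cyl_pi -Quotient.idealrBE subr0 => /cyl_idealP[h].
move/(congr1 (meval (val v))); rewrite mevalB mevalM (eqP (valP v)) mulr0.
by move/eqP; rewrite subr_eq0 => /eqP ->.
Qed.

(* A tuple of rational functions is regular when its components lie in the
   coordinate ring. *)
Definition regular (r : 'I_4 -> {fraction cylring}) :=
  forall i, exists u : cylring, u%:F = r i.

End Ring.

Section Morphism.
Variables (n d : nat) (a : 'I_d -> K) (m e : nat) (b : 'I_e -> K).

(* A morphism of affine varieties: a map on points whose pullback of functions
   is an algebra morphism between coordinate rings. *)
Record morphism := Morphism {
  pmap : cyl_pt n a -> cyl_pt m b;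
  pull : {lrmorphism cylring m b -> cylring n a};
  pullE : forall u v, cyl_eval (pull u) v = cyl_eval u (pmap v) }.

(* The morphism F is given in coordinates by the rational functions r. *)
Definition given_by (F : morphism) (r : 'I_4 -> {fraction cylring n a}) :=
  forall i, (pull F (cyl_coord m b i))%:F = r i.

(* The rational functions on the source (n, a) that form the map
   (x, y, z, w) |->
     (x, Q(g(z) + x^m w) / x^m, g(z) + x^m w, (z - f(g(z) + x^m w)) / x^n),
   to A^4, where Q = rootpoly b; exchanging (n, a, f) with (m, b, g) gives the
   map in the other direction. *)
Definition cyl_map (f g : {poly K}) : 'I_4 -> {fraction cylring n a} :=
  let x := cyl_coord n a ix in
  let z := cyl_coord n a iz in
  let w := cyl_coord n a iw in
  let u := horner_alg z g + x ^+ m * w in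
  tnth [tuple x%:F;
              (horner_alg u (rootpoly b))%:F / x%:F ^+ m;
              u%:F;
              (z - horner_alg u f)%:F / x%:F ^+ n].

End Morphism.

Definition inverse_morphisms n d (a : 'I_d -> K) m e (b : 'I_e -> K)
    (F : morphism n a m b) (G : morphism m b n a) :=
  [/\ cancel (pmap F) (pmap G), cancel (pmap G) (pmap F),
      cancel (pull F) (pull G) & cancel (pull G) (pull F)].

End Cylinder.

(* Main.v *)
(** Put [u = g(z) + x^m w]. The hypothesis on [g] says that [(z - a_i)^m]
divides [g - b_i], so [P^m] divides [Q o g]; as [P(z) = x^n y], the element
[Q(g(z))] of the coordinate ring is a multiple of [x^m], and so is [Q(u)], which
is congruent to it modulo [x^m]. Next, expand [f(u)] by Taylor's formula at
[g(z)]: the coefficients of index [1 <= k < n] are polynomials in [z] vanishing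
at every [a_i], hence multiples of [P(z) = x^n y], and the terms of index
[k >= n] are multiples of [x^(m k)]. Thus [z - f(u)] is congruent to
[z - f(g(z))], which vanishes at every [a_i], so it is a multiple of [x^n]. The
two maps are inverse to each other because [x] is not a zero divisor. *)

Require Import Defs.
From mathcomp Require Import all_boot all_order all_algebra.
From mathcomp Require Import mpoly complex reals.
From HB Require Import structures.
From mathcomp Require Import generic_quotient ring_quotient fraction boolp.

Import GRing.Theory Num.Theory.
Local Open Scope ring_scope.

(** * Derivatives, divisibility and Taylor expansion of polynomials *)

(** The k-th derivative is k! times the normalised one that enters Taylor's formula, and k! is
    nonzero in characteristic zero. *)
Lemma nderivn_eq0 (K : fieldType) (p : {poly K}) (c : K) k :
  [pchar K] =i pred0 -> p^`(k).[c] = 0 -> p^`N(k).[c] = 0.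
Proof.
move=> /pcharf0P charK; rewrite nderivn_def hornerMn -mulr_natr => /eqP.
by rewrite mulf_eq0 charK -[_ == 0%N]negbK -lt0n fact_gt0 orbF => /eqP.
Qed.

Lemma nderivn_dvdp (K : fieldType) (p : {poly K}) (c : K) n :
  (forall k, (k < n)%N -> p^`N(k).[c] = 0) -> ('X - c%:P) ^+ n %| p.
Proof.
move=> p0.
(* Coefficients become constant polynomials, so that Taylor's formula at [c] with increment
   ['X - c%:P] applies inside [{poly K}]. *)
have -> : p = (map_poly polyC p).[c%:P + ('X - c%:P)].
  by rewrite addrC subrK -[LHS]comp_polyXr.
rewrite nderiv_taylor; last exact: mulrC.
apply: (big_ind (fun q => _ %| q)) => [|q r|i _].
- exact: dvdp0.
- exact: dvdp_add.
have [/p0 E|leni] := ltnP i n; last by rewrite dvdp_mull ?dvdp_exp2l.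
by rewrite nderivn_map horner_map /= E polyC0 mul0r dvdp0.
Qed.

Lemma rootpoly_dvdp (K : fieldType) d (a : 'I_d -> K) (p : {poly K}) :
  injective a -> (forall i, p.[a i] = 0) -> rootpoly a %| p.
Proof.
move=> ha p0; rewrite /rootpoly -(big_map a predT (fun c => 'X - c%:P)).
apply: uniq_roots_dvdp; first by apply/allP => _ /mapP[i _ ->]; apply/rootP.
by rewrite uniq_rootsE map_inj_uniq ?index_enum_uniq.
Qed.

(** Composition with [g] turns the i-th linear factor of [rootpoly b] into g - b_i, so divisibility
    is checked factor by factor. *)
Lemma dvdp_rootpolyXn_comp (K : fieldType) d (a b : 'I_d -> K)
    (g : {poly K}) m :
  (forall i, ('X - (a i)%:P) ^+ m %| g - (b i)%:P) ->
  rootpoly a ^+ m %| rootpoly b \Po g.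
Proof.
move=> dvg; rewrite /rootpoly rmorph_prod -prodrXl.
elim/big_ind2: _ => [|p q r s|i _]; [exact: dvd1p|exact: dvdp_mul|].
by rewrite rmorphB /= comp_polyX comp_polyC.
Qed.

Lemma horner_algE (K : fieldType) (A : comAlgType K) (s : A) (p : {poly K}) :
  horner_alg s p = (map_poly (in_alg A) p).[s].
Proof. by []. Qed.

Lemma horner_alg_comp (K : fieldType) (A : comAlgType K) (s : A)
    (p q : {poly K}) :
  horner_alg s (p \Po q) = horner_alg (horner_alg s q) p.
Proof.
elim/poly_ind: p => [|p c IHp]; first by rewrite comp_poly0 !rmorph0.
rewrite comp_polyD comp_polyM comp_polyX comp_polyC !rmorphD !rmorphM /= IHp.
by rewrite horner_algX !horner_algC.
Qed.

Lemma rmorph_horner_alg (K : fieldType) (A B : comAlgType K)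
    (F : {lrmorphism A -> B}) (s : A) (p : {poly K}) :
  F (horner_alg s p) = horner_alg (F s) p.
Proof.
elim/poly_ind: p => [|p c IHp]; first by rewrite !rmorph0.
by rewrite !rmorphD !rmorphM /= IHp !horner_algX !horner_algC rmorph_alg.
Qed.

(** Taylor's formula at [s] with increment [t]: modulo [c] only the term of index 0 survives. *)
Lemma horner_algD_modX (K : fieldType) (A : comAlgType K) (c s t : A)
    (p : {poly K}) :
  (forall i, exists r, horner_alg s p^`N(i.+1) * t ^+ i.+1 = c * r) ->
  exists r, horner_alg (s + t) p = horner_alg s p + c * r.
Proof.
move=> dvc; rewrite horner_algE (nderiv_taylor_wide (n := (size p).+1));
  [|exact: mulrC|by rewrite size_map_poly].
rewrite big_ord_recl /= nderivn0 mulr1.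
suff [r ->] : exists r,
    \sum_(i < size p) (map_poly (in_alg A) p)^`N(bump 0 i).[s] * t ^+ bump 0 i
      = c * r by exists r.
apply: (big_ind (fun u => exists r, u = c * r)) => [|_ _ [r1 ->] [r2 ->]|i _].
- by exists 0; rewrite mulr0.
- by exists (r1 + r2); rewrite mulrDr.
by rewrite nderivn_map; apply: dvc.
Qed.

(** * Divisibility by powers of x, at a point of the cylinder with values in any algebra *)

Section CylinderPoint.
Variables (K : fieldType) (A : comAlgType K) (n m d : nat).
Variables (a b : 'I_d -> K) (f g : {poly K}).
Hypotheses (n_gt0 : (0 < n)%N) (m_gt0 : (0 < m)%N) (ha : injective a).
Hypothesis fb : forall i, f.[b i] = a i.
Hypothesis df : forall i k, (0 < k < n)%N -> f^`N(k).[b i] = 0.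
Hypothesis ga : forall i, g.[a i] = b i.
Hypothesis dg : forall i k, (0 < k < m)%N -> g^`N(k).[a i] = 0.
Variables (x y z w : A).
Hypothesis eqn_xyz : x ^+ n * y = horner_alg z (rootpoly a).

Lemma horner_alg_dvdp_rootpoly p :
  rootpoly a %| p -> exists t, horner_alg z p = x ^+ n * t.
Proof.
case/dvdpP=> q ->; exists (horner_alg z q * y).
by rewrite rmorphM /= -eqn_xyz mulrCA.
Qed.

Lemma cyl_map_y_regular :
  exists t, x ^+ m * t = horner_alg (horner_alg z g + x ^+ m * w) (rootpoly b).
Proof.
have [q E] : exists q, rootpoly b \Po g = q * rootpoly a ^+ m.
  apply/dvdpP/dvdp_rootpolyXn_comp => i; apply: nderivn_dvdp => k lekm.
  rewrite nderivnB hornerD hornerN.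
  case: k lekm => [|k] lekm; first by rewrite !nderivn0 hornerC ga subrr.
  by rewrite nderivnC hornerC subr0 dg.
have [t ->] : exists t, horner_alg (horner_alg z g + x ^+ m * w) (rootpoly b)
    = horner_alg (horner_alg z g) (rootpoly b) + x ^+ m * t.
  apply: horner_algD_modX => i.
  by exists (horner_alg (horner_alg z g) (rootpoly b)^`N(i.+1)
             * (w * (x ^+ m * w) ^+ i)); rewrite exprS -mulrA mulrCA.
(* Apart from the remainder [t], the value is a multiple of P(z)^m = x^(nm) y^m, from which x^m
   splits off since n >= 1. *)
exists (horner_alg z q * (x ^+ (n.-1 * m) * y ^+ m) + t).
rewrite -horner_alg_comp E rmorphM rmorphXn /= -eqn_xyz mulrDr; congr (_ + _).
rewrite mulrCA; congr (_ * _).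
rewrite mulrA exprMn -exprM -exprD; congr (_ ^+ _ * _).
by rewrite -[in RHS](prednK n_gt0) mulSn.
Qed.

Lemma cyl_map_w_regular :
  exists t, x ^+ n * t = z - horner_alg (horner_alg z g + x ^+ m * w) f.
Proof.
have [t ->] : exists t, horner_alg (horner_alg z g + x ^+ m * w) f
    = horner_alg (horner_alg z g) f + x ^+ n * t.
  apply: horner_algD_modX => i; have [ltin|leni] := ltnP i.+1 n.
    (* Below order n, the derivative of f vanishes at g(a_j) = b_j, so its composite with g is
       divisible by P. *)
    have [t E] : exists t,
        horner_alg z (f^`N(i.+1) \Po g) = x ^+ n * t.
      apply: horner_alg_dvdp_rootpoly; apply: rootpoly_dvdp => // j.
      by rewrite horner_comp ga df.
    by exists (t * (x ^+ m * w) ^+ i.+1); rewrite -horner_alg_comp E mulrA.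
  (* From order n on, the power of x^m w already carries x^n, because m(i+1) >= n when m >= 1. *)
  exists (horner_alg (horner_alg z g) f^`N(i.+1)
          * (x ^+ (m * i.+1 - n) * w ^+ i.+1)).
  rewrite [RHS]mulrCA; congr (_ * _).
  rewrite exprMn -exprM mulrA -exprD subnKC //.
  by rewrite (leq_trans leni) // leq_pmull.
(* Each a_j is a fixed point of f composed with g. *)
have [r E] : exists r, horner_alg z ('X - (f \Po g)) = x ^+ n * r.
  apply: horner_alg_dvdp_rootpoly; apply: rootpoly_dvdp => // j.
  by rewrite hornerD hornerN hornerX horner_comp ga fb subrr.
exists (r - t); rewrite mulrBr -E rmorphB /= horner_algX horner_alg_comp.
by rewrite opprD addrA.
Qed.

End CylinderPoint.

(** Universal property of the polynomial algebra: [mmap] is already a ring morphism, and linearity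
    over [K] is added. *)
Lemma mpoly_lift (K : fieldType) (B : comAlgType K) k (v : 'I_k -> B) :
  exists h : {lrmorphism {mpoly K[k]} -> B}, forall i, h 'X_i = v i.
Proof.
pose h := mmap (in_alg B) v.
have hZ : scalable h by move=> c p; rewrite /h mmapZ mulr_algl.
pose hS := GRing.isScalable.Build K {mpoly K[k]} B *:%R h hZ.
pose hL : {lrmorphism {mpoly K[k]} -> B} := HB.pack h hS.
by exists hL => i; rewrite /hL /= /h mmapX mmap1U.
Qed.

Lemma meval_horner_alg (K : fieldType) k (v : 'I_k -> K) i (p : {poly K}) :
  (horner_alg ('X_i : {mpoly K[k]}) p).@[v] = p.[v i].
Proof.
elim/poly_ind: p => [|p c IHp]; first by rewrite rmorph0 meval0 horner0.
rewrite rmorphD rmorphM /= horner_algX horner_algC mevalD mevalM mevalXU IHp.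
by rewrite alg_mpolyC mevalC hornerMXaddC.
Qed.

(** * The coordinate ring: universal property, evaluation at points, nonvanishing of x *)

Section CoordinateRing.
Variables (K : fieldType) (n d : nat) (a : 'I_d -> K).
Local Notation pi := (@cyl_pi K n d a).

Lemma cyl_pi_scalable : scalable pi.
Proof. by move=> c p; rewrite -mul_mpolyC rmorphM. Qed.

HB.instance Definition _ :=
  GRing.isScalable.Build K {mpoly K[4]} (cylring n a) *:%R pi cyl_pi_scalable.

Lemma cyl_piK u : pi (repr u) = u.
Proof. exact: reprK. Qed.

Lemma cyl_pi_eq0 p : (pi p == 0) = (p \in cyl_ideal n a).
Proof. by rewrite -(rmorph0 pi) /cyl_pi -Quotient.idealrBE subr0. Qed.

Lemma cyl_pi_eqn : pi (cyl_eqn n a) = 0.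
Proof.
by apply/eqP; rewrite cyl_pi_eq0; apply/cyl_idealP; exists 1; rewrite mul1r.
Qed.

Lemma cyl_coord_eqn :
  cyl_coord n a ix ^+ n * cyl_coord n a iy
    = horner_alg (cyl_coord n a iz) (rootpoly a).
Proof.
apply/eqP; rewrite -subr_eq0 -(rmorph_horner_alg _ _ _ pi) -rmorphXn -rmorphM.
by rewrite -rmorphB; apply/eqP/cyl_pi_eqn.
Qed.

Lemma cyl_ring_ind (S : cylring n a -> Prop) :
    (forall c, S c%:A) -> (forall i, S (cyl_coord n a i)) ->
    (forall u v, S u -> S v -> S (u + v)) ->
    (forall u v, S u -> S v -> S (u * v)) ->
  forall u, S u.
Proof.
move=> SC SX SD SM u; rewrite -[u]cyl_piK.
apply: (@mpoly_ring_ind _ _ (fun p => S (pi p))) => [c|i|p q|p q].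
- by rewrite -alg_mpolyC rmorph_alg.
- exact: SX.
- by rewrite rmorphD; apply: SD.
- by rewrite rmorphM; apply: SM.
Qed.

Lemma cyl_lrmorphism_ext (B : comAlgType K)
    (F G : {lrmorphism cylring n a -> B}) :
  (forall i, F (cyl_coord n a i) = G (cyl_coord n a i)) -> F =1 G.
Proof.
move=> FG; apply: cyl_ring_ind => [c||u v|u v] //; first by rewrite !rmorph_alg.
  by move=> Eu Ev; rewrite !rmorphD /= Eu Ev.
by move=> Eu Ev; rewrite !rmorphM /= Eu Ev.
Qed.

(** Universal property of the quotient: a morphism on polynomials that kills the equation
    descends. *)
Lemma cyl_lift (B : comAlgType K) (v : 'I_4 -> B) :
  v ix ^+ n * v iy = horner_alg (v iz) (rootpoly a) ->
  exists F : {lrmorphism cylring n a -> B}, forall i, F (cyl_coord n a i) = v i.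
Proof.
move=> eqn_v; have [h hX] := mpoly_lift K B 4 v.
have h_eqn : h (cyl_eqn n a) = 0.
  rewrite rmorphB rmorphM rmorphXn /= !hX (rmorph_horner_alg _ _ _ h) hX.
  by rewrite eqn_v subrr.
pose F0 (u : cylring n a) := h (repr u).
(* The chosen representative differs from [p] by a multiple of the equation, so [F0] inherits the
   algebra laws from [h]. *)
have F0E p : F0 (pi p) = h p.
  apply/eqP; rewrite -subr_eq0 -rmorphB.
  have : repr (pi p) - p \in cyl_ideal n a.
    by rewrite -cyl_pi_eq0 rmorphB /= cyl_piK subrr.
  by case/cyl_idealP=> q ->; rewrite rmorphM /= h_eqn mulr0.
have FB : zmod_morphism F0.
  by move=> u1 u2; rewrite -[u1]cyl_piK -[u2]cyl_piK -rmorphB !F0E rmorphB.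
have FM : monoid_morphism F0.
  split=> [|u1 u2]; first by rewrite -(rmorph1 pi) F0E rmorph1.
  by rewrite -[u1]cyl_piK -[u2]cyl_piK -rmorphM !F0E rmorphM.
have FZ : scalable F0.
  by move=> c u; rewrite -[u]cyl_piK -linearZ !F0E linearZ.
pose FBm := GRing.isZmodMorphism.Build (cylring n a) B F0 FB.
pose FMm := GRing.isMonoidMorphism.Build (cylring n a) B F0 FM.
pose FZm := GRing.isScalable.Build K (cylring n a) B *:%R F0 FZ.
pose F : {lrmorphism cylring n a -> B} := HB.pack F0 FBm FMm FZm.
by exists F => i; rewrite -hX -F0E.
Qed.

Lemma cyl_eval_coord i v : cyl_eval (cyl_coord n a i) v = val v i.
Proof. by rewrite cyl_evalE mevalXU. Qed.

Lemma cyl_evalA c v : cyl_eval (c%:A : cylring n a) v = c.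
Proof. by rewrite -(rmorph_alg pi) cyl_evalE alg_mpolyC mevalC. Qed.

Lemma cyl_evalD u1 u2 v :
  cyl_eval (u1 + u2 : cylring n a) v = cyl_eval u1 v + cyl_eval u2 v.
Proof.
by rewrite -[u1]cyl_piK -[u2]cyl_piK -rmorphD !cyl_evalE mevalD.
Qed.

Lemma cyl_evalM u1 u2 v :
  cyl_eval (u1 * u2 : cylring n a) v = cyl_eval u1 v * cyl_eval u2 v.
Proof.
by rewrite -[u1]cyl_piK -[u2]cyl_piK -rmorphM !cyl_evalE mevalM.
Qed.

(** The point (1, P(0), 0, 0) lies on the cylinder, and x equals 1 there. As the ring is a domain,
    powers of x can be cancelled. *)
Lemma cyl_coord_ix_neq0 : cyl_coord n a ix != 0.
Proof.
pose v := [ffun i : 'I_4 => if i == ix then 1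
                            else if i == iy then (rootpoly a).[0] else 0 : K].
have v0 : (cyl_eqn n a).@[v] == 0.
  rewrite mevalB mevalM rmorphXn /= !mevalXU meval_horner_alg !ffunE /=.
  by rewrite expr1n mul1r subrr.
apply/eqP => /(congr1 (fun u => cyl_eval u (exist _ v v0))).
rewrite cyl_eval_coord -(rmorph0 pi) cyl_evalE meval0 ffunE eqxx.
by apply/eqP/oner_neq0.
Qed.

End CoordinateRing.

(** * Morphisms of cylinders and the displayed maps *)

(** The map on points is forced: the coordinates of the image of [v] are the values at [v] of the
    pulled-back coordinate functions. *)
Lemma morphism_of_pull (K : fieldType) n d (a : 'I_d -> K) m e (b : 'I_e -> K)
    (F : {lrmorphism cylring m b -> cylring n a}) :
  exists M : morphism n a m b, pull M = F.
Proof.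
pose c (v : cyl_pt n a) : {ffun 'I_4 -> K} :=
  [ffun i => cyl_eval (F (cyl_coord m b i)) v].
have FE v p : cyl_eval (F (cyl_pi m b p)) v = p.@[c v].
  move: p; apply: mpoly_ring_ind => [k|i|p q Ep Eq|p q Ep Eq].
  - by rewrite -alg_mpolyC !rmorph_alg cyl_evalA alg_mpolyC mevalC.
  - by rewrite mevalXU ffunE.
  - by rewrite !rmorphD /= cyl_evalD Ep Eq.
  - by rewrite !rmorphM /= cyl_evalM Ep Eq.
have c0 v : (cyl_eqn m b).@[c v] == 0.
  by rewrite -FE cyl_pi_eqn rmorph0 -(scale0r 1) cyl_evalA.
have pullE u v : cyl_eval (F u) v = cyl_eval u (exist _ (c v) (c0 v)).
  by rewrite -[u]cyl_piK FE cyl_evalE.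
by exists (Morphism pullE).
Qed.

Section CylinderMap.
Variables (K : fieldType) (n m d : nat) (a b : 'I_d -> K) (f g : {poly K}).

Local Notation X := (cyl_coord n a ix).
Local Notation Z := (cyl_coord n a iz).
Local Notation W := (cyl_coord n a iw).
Local Notation U := (horner_alg Z g + X ^+ m * W).

Lemma tofrac_divXn k (p q : cylring n a) :
  tofrac q = tofrac p / tofrac X ^+ k <-> X ^+ k * q = p.
Proof.
have X0 : tofrac X ^+ k != 0.
  by rewrite expf_neq0 // tofrac_eq0 cyl_coord_ix_neq0.
split=> [E|<-]; last by rewrite rmorphM rmorphXn /= mulrC mulKf.
by apply/eqP; rewrite -tofrac_eq rmorphM rmorphXn /= E mulrC divfK.
Qed.

(** Clearing denominators gives equations in the coordinate ring itself, where morphisms can be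
    applied to them. *)
Lemma given_by_cyl_mapP (F : morphism n a m b) :
  given_by F (cyl_map n a m b f g) <->
  [/\ pull F (cyl_coord m b ix) = X,
      X ^+ m * pull F (cyl_coord m b iy) = horner_alg U (rootpoly b),
      pull F (cyl_coord m b iz) = U &
      X ^+ n * pull F (cyl_coord m b iw) = Z - horner_alg U f].
Proof.
split=> [FE|[Ex Ey Ez Ew] i].
  split.
  - by apply/eqP; rewrite -tofrac_eq; apply/eqP/(FE ix).
  - by apply/tofrac_divXn/(FE iy).
  - by apply/eqP; rewrite -tofrac_eq; apply/eqP/(FE iz).
  - by apply/tofrac_divXn/(FE iw).
case: i => [[|[|[|[|//]]]] lti].
- by rewrite (_ : Ordinal lti = ix) ?Ex //; apply: val_inj.
- by rewrite (_ : Ordinal lti = iy); [apply/tofrac_divXn|apply: val_inj].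
- by rewrite (_ : Ordinal lti = iz) ?Ez //; apply: val_inj.
- by rewrite (_ : Ordinal lti = iw); [apply/tofrac_divXn|apply: val_inj].
Qed.

Hypotheses (n_gt0 : (0 < n)%N) (m_gt0 : (0 < m)%N) (ha : injective a).
Hypothesis fb : forall i, f.[b i] = a i.
Hypothesis df : forall i k, (0 < k < n)%N -> f^`N(k).[b i] = 0.
Hypothesis ga : forall i, g.[a i] = b i.
Hypothesis dg : forall i k, (0 < k < m)%N -> g^`N(k).[a i] = 0.

Lemma cyl_map_morphism :
  exists F : morphism n a m b, given_by F (cyl_map n a m b f g).
Proof.
have [y' Ey] := cyl_map_y_regular K _ n m d a b g n_gt0 ga dg _ _ _ W
  (cyl_coord_eqn K n d a).
have [w' Ew] := cyl_map_w_regular K _ n m d a b f g m_gt0 ha fb df ga _ _ _ W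
  (cyl_coord_eqn K n d a).
(* The tuple is a point of the target cylinder over the source ring; its equation is exactly
   [Ey]. *)
have [F FE] := cyl_lift K m d b (cylring n a) (tnth [tuple X; y'; U; w']) Ey.
have [M MF] := morphism_of_pull _ _ _ _ _ _ _ F.
by exists M; apply/given_by_cyl_mapP; rewrite MF !FE; split.
Qed.

End CylinderMap.

(** One composite suffices, since the data of the two maps are interchangeable. It is computed on
    coordinates, starting with z, on which y and w depend. *)
Lemma cyl_map_cancel (K : fieldType) n m d (a b : 'I_d -> K) (f g : {poly K})
    (F : morphism n a m b) (G : morphism m b n a) :
  given_by F (cyl_map n a m b f g) -> given_by G (cyl_map m b n a g f) ->
  cancel (pull G) (pull F) /\ cancel (Defs.pmap F) (Defs.pmap G).
Proof.
move=> /given_by_cyl_mapP[Fx _ Fz Fw] /given_by_cyl_mapP[Gx Gy Gz Gw].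
have FGz : pull F (pull G (cyl_coord n a iz)) = cyl_coord n a iz.
  rewrite Gz rmorphD rmorphM rmorphXn /= Fx Fw.
  by rewrite (rmorph_horner_alg _ _ _ (pull F)) Fz addrC subrK.
have Xreg k : injective ( *%R (cyl_coord n a ix ^+ k)).
  by apply: mulfI; rewrite expf_neq0 ?cyl_coord_ix_neq0.
have FG i : pull F (pull G (cyl_coord n a i)) = cyl_coord n a i.
  case: i => [[|[|[|[|//]]]] lti].
  - by rewrite (_ : Ordinal lti = ix); [rewrite Gx; apply: Fx|apply: val_inj].
  - rewrite (_ : Ordinal lti = iy); last exact: val_inj.
    (* After multiplication by x^n both sides equal P(z). *)
    apply: (Xreg n); rewrite -[in LHS]Fx -rmorphXn -rmorphM /= Gy -Gz.
    by rewrite (rmorph_horner_alg _ _ _ (pull F)) FGz cyl_coord_eqn.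
  - by rewrite (_ : Ordinal lti = iz); [rewrite FGz|apply: val_inj].
  - rewrite (_ : Ordinal lti = iw); last exact: val_inj.
    (* After multiplication by x^m the left side is (g(z) + x^m w) - g(z). *)
    apply: (Xreg m); rewrite -[in LHS]Fx -rmorphXn -rmorphM /= Gw -Gz.
    by rewrite rmorphB /= (rmorph_horner_alg _ _ _ (pull F)) FGz Fz addrC addKr.
split=> [u|v].
  exact: (cyl_lrmorphism_ext _ _ _ _ _
    (pull F \o pull G : {lrmorphism cylring n a -> cylring n a}) idfun FG u).
(* Points are determined by the values of the coordinate functions, so the identity of pullbacks
   passes to points. *)
by apply/val_inj/ffunP => i; rewrite -!cyl_eval_coord -!pullE FG.
Qed.

Lemma given_by_regular (K : fieldType) n d (a : 'I_d -> K) m e (b : 'I_e -> K)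
    (F : morphism n a m b) r : given_by F r -> regular r.
Proof. by move=> FE i; exists (pull F (cyl_coord m b i)); apply: FE. Qed.

Lemma cyl_map_inverse (K : fieldType) n m d (a b : 'I_d -> K) (f g : {poly K})
    (F : morphism n a m b) (G : morphism m b n a) :
  given_by F (cyl_map n a m b f g) -> given_by G (cyl_map m b n a g f) ->
  inverse_morphisms F G.
Proof.
move=> FE GE; have [PQ PQ'] := cyl_map_cancel _ _ _ _ _ _ _ _ _ _ FE GE.
have [QP QP'] := cyl_map_cancel _ _ _ _ _ _ _ _ _ _ GE FE.
by split.
Qed.

(** * The result in characteristic zero, then over the complex numbers *)

Lemma cyl_map_inverse_morphisms (K : fieldType) (d n m : nat)
    (charK : [pchar K] =i pred0) (hn : (1 <= n)%N) (hm : (1 <= m)%N)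
    (a b : 'I_d -> K) (ha : injective a) (hb : injective b)
    (f g : {poly K})
    (hf : forall i, f.[b i] = a i /\
       forall k, (1 <= k <= n - 1)%N -> f^`(k).[b i] = 0)
    (hg : forall i, g.[a i] = b i /\
       forall k, (1 <= k <= m - 1)%N -> g^`(k).[a i] = 0) :
  let phi := cyl_map n a m b f g in
  let psi := cyl_map m b n a g f in
  [/\ regular phi, regular psi &
      exists (Phi : morphism n a m b) (Psi : morphism m b n a),
        [/\ given_by Phi phi, given_by Psi psi & inverse_morphisms Phi Psi]].
Proof.
have fb i : f.[b i] = a i by case: (hf i).
have ga i : g.[a i] = b i by case: (hg i).
have df i k : (0 < k < n)%N -> f^`N(k).[b i] = 0.
  move=> /andP[k0 ltkn]; apply: nderivn_eq0 => //; case: (hf i) => _; apply.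
  by rewrite k0 subn1 -ltnS prednK.
have dg i k : (0 < k < m)%N -> g^`N(k).[a i] = 0.
  move=> /andP[k0 ltkm]; apply: nderivn_eq0 => //; case: (hg i) => _; apply.
  by rewrite k0 subn1 -ltnS prednK.
have [Phi HPhi] := cyl_map_morphism _ n m d a b f g hn hm ha fb df ga dg.
(* The inverse comes from exchanging (n, a, f) with (m, b, g). *)
have [Psi HPsi] := cyl_map_morphism _ m n d b a g f hm hn hb ga dg fb df.
move=> phi psi; split; [exact: given_by_regular HPhi| |].
  exact: given_by_regular HPsi.
exists Phi, Psi; split; [exact: HPhi|exact: HPsi|].
exact: cyl_map_inverse HPhi HPsi.
Qed.

Theorem proposition5p2p1 (R : realType) (d n m : nat)
    (hd : (1 <= d)%N) (hn : (1 <= n)%N) (hm : (1 <= m)%N)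
    (a b : 'I_d -> R[i]) (ha : injective a) (hb : injective b)
    (f g : {poly R[i]})
    (hf : forall i, f.[b i] = a i /\
       forall k, (1 <= k <= n - 1)%N -> f^`(k).[b i] = 0)
    (hg : forall i, g.[a i] = b i /\
       forall k, (1 <= k <= m - 1)%N -> g^`(k).[a i] = 0) :
  let phi := cyl_map n a m b f g in
  let psi := cyl_map m b n a g f in
  [/\ regular phi, regular psi &
      exists (Phi : morphism n a m b) (Psi : morphism m b n a),
        [/\ given_by Phi phi, given_by Psi psi & inverse_morphisms Phi Psi]].
Proof.
apply: cyl_map_inverse_morphisms => //; exact: pchar_num.
Qed.
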